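(* Let $1\le k\le n$, let $X_1,\ldots,X_n,Z$ be random variables with an arbitrary joint discrete distribution, taking only non-negative integers as values, and let $T=\min(X_{n-k+1:n}+Z,\,X_{n-k+2:n})$. Let $t$ be a non-negative integer with $P(T>t)>0$. Then $$P(T-t>s\mid T>t)=\frac{P(T>t+s)}{P(T>t)},\quad s=0,1,\ldots,$$ and $$E(T-t\mid T>t)=\frac1{P(T>t)}\sum_{s=t}^{\infty}P(T>s).$$
   Context: $X_{1:n}\le\cdots\le X_{n:n}$ are the order statistics of $X_1,\ldots,X_n$ and $X_{n+1:n}:=\infty$ (so $T=X_{n:n}+Z$ for $k=1$). $T$ is the lifetime of a $k$-out-of-$n$ system with active component lifetimes $X_1,\ldots,X_n$ and one cold standby unit with lifetime $Z$. Expectations are taken in $[0,\infty]$. *)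

(* Defs.v *)
From HB Require Import structures.
From mathcomp Require Import all_boot all_order all_algebra.
From mathcomp Require Import all_classical all_reals all_analysis.
Import Order.TTheory GRing.Theory Num.Theory.

Set Implicit Arguments.
Unset Strict Implicit.
Unset Printing Implicit Defensive.

Local Open Scope classical_set_scope.
Local Open Scope ring_scope.
Local Open Scope ereal_scope.

(* X_{j:n}, 1-based: indices j > n fall outside the sorted sequence and give
   the default value, so X_{n+1:n} = +oo. Meaningful for j >= 1 only. *)
Definition order_stat (R : realType) (n : nat) (x : 'I_n -> R) (j : nat) :
    \bar R :=
  nth +oo (sort <=%O [seq (x i)%:E | i <- enum 'I_n]) j.-1.

(* For 1 <= k <= n the first argument of the minimum, hence the lifetime,
   is finite. *)
Definition standby_lifetime (R : realType) (n k : nat) (x : 'I_n -> R) (z : R) :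
    \bar R :=
  Order.min (order_stat x (n - k + 1)%N + z%:E) (order_stat x (n - k + 2)%N).

(* A |-> P(A | B), for 0 < P B. *)
Definition cond_prob (d : measure_display) (Omega : measurableType d)
    (R : realType) (P : probability Omega R) (B : set Omega) :
    set Omega -> \bar R :=
  fun A => P (A `&` B) / P B.

(* E(Y | B) for an event B with 0 < P B: expectation under P(. | B). *)
Definition cond_expectation (d : measure_display) (Omega : measurableType d)
    (R : realType) (P : probability Omega R) (B : set Omega)
    (Y : Omega -> \bar R) : \bar R :=
  \int[cond_prob P B]_w Y w.

(* Main.v *)
(* T is a function of finitely many variables with values in the naturals, hence
   itself has natural values and every event about T is measurable. On {T > t}
   the residual life T - t is the natural number N - t, and E (N - t) is the sum
   of its tail probabilities by monotone convergence, applied to the conditional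
   probability viewed as a scaled restriction of P. *)

Require Import Defs.
From HB Require Import structures.
From mathcomp Require Import all_boot all_order all_algebra.
From mathcomp Require Import all_classical all_reals all_analysis.
From mathcomp Require Import measurable_realfun.
Import Order.TTheory GRing.Theory Num.Theory.

Local Open Scope classical_set_scope.
Local Open Scope ring_scope.
Local Open Scope ereal_scope.

Lemma order_stat_mem (R : realType) (n : nat) (x : 'I_n -> R) (j : nat) :
  (j.-1 < n)%N -> exists i, order_stat x j = (x i)%:E.
Proof.
move=> jn; set s := sort <=%O [seq (x i)%:E | i <- enum 'I_n].
have: nth +oo s j.-1 \in s.
  by rewrite mem_nth// size_sort size_map size_enum_ord.
by rewrite mem_sort => /mapP[i _ xi]; exists i.
Qed.

Lemma order_stat_default (R : realType) (n : nat) (x : 'I_n -> R) (j : nat) :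
  (n <= j.-1)%N -> order_stat x j = +oo.
Proof.
by move=> nj; apply: nth_default; rewrite size_sort size_map size_enum_ord.
Qed.

(** For [1 <= k <= n] the index [n - k + 1] lies between 1 and [n], so the first argument of the
    minimum is a sum of two naturals. The second is again a component lifetime, except for [k = 1]:
    there it is the default [+oo] and the minimum is the first. *)
Lemma standby_lifetime_nat (R : realType) (n k : nat) (x : 'I_n -> R) (z : R) :
  (1 <= k <= n)%N -> (forall i, x i \is a Num.nat) -> z \is a Num.nat ->
  exists m : nat, standby_lifetime k x z = m%:R%:E.
Proof.
move=> /andP[k1 kn] hx /natrP[c zc]; rewrite /standby_lifetime.
have [|i ->] := @order_stat_mem _ _ x (n - k + 1)%N.
  by rewrite addn1 /= ltn_subrL k1 (leq_trans k1 kn).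
have /natrP[a ->] := hx i; rewrite zc -EFinD -natrD.
have [lt|ge] := ltnP (n - k + 2).-1 n; last first.
  by exists (a + c)%N; rewrite order_stat_default// minEle leey.
have [i' ->] := @order_stat_mem _ _ x (n - k + 2)%N lt.
have /natrP[b ->] := hx i'.
by rewrite minEle; case: ifP => _; [exists (a + c)%N|exists b].
Qed.

(** Any preimage is a union of fibres, and countably many of them suffice. *)
Lemma measurable_preimage_countType (d : measure_display)
    (Omega : measurableType d) (U : countType) (f : Omega -> U) :
  (forall u, measurable (f @^-1` [set u])) -> forall A, measurable (f @^-1` A).
Proof.
move=> mf A; rewrite (_ : f @^-1` A = \bigcup_(u in A) f @^-1` [set u]).
  rewrite bigcup_mkcond; apply: countable_bigcupT_measurable => // u.
  by case: ifP.
by apply/seteqP; split => [w Aw|w [u Au /= ->]//]; exists (f w).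
Qed.

(* X and Z jointly factor through the countable type of natural tuples, so no
   regularity of F is needed. *)
Lemma measurable_preimage_natr (R : realType) (d : measure_display)
    (Omega : measurableType d) (n : nat) (X : 'I_n -> Omega -> R)
    (Z : Omega -> R) (T : Type) (F : ('I_n -> R) -> R -> T) :
  (forall i, measurable_fun setT (X i)) -> measurable_fun setT Z ->
  (forall i w, X i w \is a Num.nat) -> (forall w, Z w \is a Num.nat) ->
  forall A, measurable [set w | A (F (X^~ w) (Z w))].
Proof.
move=> mX mZ hX hZ A.
(* A finite function stores the tuple in a [countType]; truncation loses nothing on natural
   values. *)
pose f w : {ffun 'I_n -> nat} * nat :=
  ([ffun i => Num.truncn (X i w)], Num.truncn (Z w)).
have XE w i : X i w = ((f w).1 i)%:R by rewrite ffunE; have /natrP[m ->] := hX i w; rewrite natrK.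
have ZE w : Z w = (f w).2%:R by rewrite /f /=; have /natrP[m ->] := hZ w; rewrite natrK.
rewrite [X in measurable X](_ : _ =
    f @^-1` [set u : {ffun 'I_n -> nat} * nat |
      A (F (fun i => (u.1 i)%:R%R) u.2%:R%R)]); last first.
  by apply/funext => w /=; rewrite -ZE; congr (A (F _ _)); apply/funext => i.
apply: measurable_preimage_countType => u.
rewrite (_ : f @^-1` _ = \bigcap_(i in [set: 'I_n]) X i @^-1` [set (u.1 i)%:R%R]
    `&` Z @^-1` [set u.2%:R%R]).
  apply: measurableI; last by rewrite -[X in measurable X]setTI; exact: mZ.
  apply: fin_bigcap_measurable => // i _.
  by rewrite -[X in measurable X]setTI; exact: mX.
apply/seteqP; split => [w /= <-|w /= [Xw Zw]].
  by split => [i _ /=|]; rewrite -?XE -?ZE.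
apply/eqP; rewrite (surjective_pairing u) xpair_eqE; apply/andP; split.
  by apply/eqP/ffunP => i; rewrite ffunE (Xw i)// natrK.
by rewrite Zw natrK.
Qed.

Lemma nneseries_ltn (R : realType) (m : nat) :
  \sum_(0 <= s <oo) (s < m)%N%:R%:E = m%:R%:E :> \bar R.
Proof.
rewrite (nneseries_split 0 m) => [|s _]; last by rewrite lee_fin ler0n.
rewrite add0n [X in _ + X]eseries0 ?adde0; last first.
  by move=> s ms _; rewrite ltnNge ms.
rewrite (eq_big_nat _ _ (F2 := fun=> 1%:E)) => [|s /andP[_ ->]//].
by rewrite sumEFin big_const_nat iter_addr_0 subn0.
Qed.

(** Pointwise, [N] is the sum over [s] of the indicators of [s < N]; these are non-negative, so sum
    and integral can be exchanged. *)
Lemma ge0_integral_natr_tail (d : measure_display) (T : measurableType d)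
    (R : realType) (mu : {measure set T -> \bar R}) (N : T -> nat) :
  (forall s, measurable [set w | (s < N w)%N]) ->
  \int[mu]_w (N w)%:R%:E = \sum_(0 <= s <oo) mu [set w | (s < N w)%N].
Proof.
move=> mN; pose A s := [set w | (s < N w)%N].
transitivity (\int[mu]_w \sum_(0 <= s <oo) (\1_(A s) w)%:E).
  apply: eq_integral => w _; rewrite -nneseries_ltn.
  apply: eq_eseriesr => s _; rewrite indicE; congr (_%:R%:E).
  by congr nat_of_bool; apply/idP/idP; rewrite /A inE.
rewrite integral_nneseries//.
- apply: eq_eseriesr => s _; rewrite integral_indic//; last exact: mN.
  by rewrite setIT.
- by move=> s; apply/measurable_EFinP/measurable_indic; exact: mN.
Qed.

(** [cond_prob] is a bare set function; the right-hand side carries a measure structure, which makes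
    the integration lemmas applicable. *)
Lemma cond_probE (d : measure_display) (Omega : measurableType d)
    (R : realType) (P : probability Omega R) (B : set Omega)
    (mB : measurable B) :
  0 < P B -> exists r : {nonneg R},
    cond_prob P B = mscale r (mrestr P mB) :> (set Omega -> \bar R).
Proof.
move=> PB0; have PBfin : P B \is a fin_num by exact: fin_num_measure.
have c0 : (0 <= (fine (P B))^-1)%R by rewrite invr_ge0 fine_ge0.
exists (NngNum c0); apply/funext => A; rewrite /cond_prob /mscale /mrestr /=.
(* [inver] separates the inverse of 0, a case that [0 < P B] excludes. *)
rewrite muleC -[in LHS](fineK PBfin) inver.
by rewrite gt_eqF ?fine_gt0 ?PB0 -?ge0_fin_numE.
Qed.

Theorem proposition3p1 (R : realType) (d : measure_display)
    (Omega : measurableType d) (P : probability Omega R)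
    (n k : nat) (hk : (1 <= k <= n)%N)
    (X : 'I_n -> {dRV P >-> R}) (Z : {dRV P >-> R})
    (hX : forall (i : 'I_n) (w : Omega), X i w \is a Num.nat)
    (hZ : forall w : Omega, Z w \is a Num.nat)
    (t : nat) :
  let T := fun w : Omega => standby_lifetime k (fun i => X i w) (Z w) in
  0 < P [set w | t%:R%:E < T w] ->
  (forall s : nat,
     cond_prob P [set w | t%:R%:E < T w] [set w | s%:R%:E < T w - t%:R%:E]
     = P [set w | (t + s)%:R%:E < T w] / P [set w | t%:R%:E < T w])
  /\
  cond_expectation P [set w | t%:R%:E < T w] (fun w => T w - t%:R%:E)
  = (P [set w | t%:R%:E < T w])^-1
    * \sum_(t <= s <oo) P [set w | s%:R%:E < T w].
Proof.
move=> T; set B := [set w | t%:R%:E < T w] => PB0.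
have mT A : measurable (T @^-1` A).
  by apply: (@measurable_preimage_natr _ _ _ _ X Z _ (@standby_lifetime R n k)).
have mB : measurable B by exact: (mT [set y | t%:R%:E < y]).
have PBfin : P B \is a fin_num by exact: fin_num_measure.
have /choice[N TN] : forall w, exists m : nat, T w = m%:R%:E.
  by move=> w; exact: standby_lifetime_nat.
have tailE s : [set w | s%:R%:E < T w] = [set w | (s < N w)%N].
  by apply/funext => w /=; rewrite TN lte_fin ltr_nat.
have mN s : measurable [set w | (s < N w)%N].
  by rewrite -tailE; exact: (mT [set y | s%:R%:E < y]).
split=> [s|].
  rewrite /cond_prob; congr (P _ / _); rewrite /B !tailE.
  (* The event becomes [t + s < N], which already implies [t < N], that is, [B]. *)
  apply/seteqP; split => w /=; rewrite TN -EFinB lte_fin ltrBrDl -natrD ltr_nat.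
    by case.
  by move=> tsN; split => //; exact: leq_ltn_trans (leq_addr _ _) tsN.
have [r rE] := cond_probE _ _ _ _ _ mB PB0.
rewrite /cond_expectation rE.
set mu : {measure set Omega -> \bar R} := mscale r (mrestr P mB).
have muE A : mu A = P (A `&` B) / P B by rewrite -/(cond_prob P B A) rE.
(* T - t may be negative off B, a mu-null set; truncated subtraction repairs
   it there. *)
transitivity (\int[mu]_w (N w - t)%N%:R%:E).
  apply: ae_eq_integral => //.
  - move=> _ Y _; rewrite setTI.
    exact: (mT [set y | Y (y - t%:R%:E)]).
  - move=> _ Y _; rewrite setTI.
    (* [N] comes from a choice, but it is a function of [T], namely [Num.truncn (fine T)], so [mT]
       covers it too. *)
    rewrite [X in measurable X](_ : _ =
       T @^-1` [set y | Y (Num.truncn (fine y) - t)%N%:R%:E])//.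
    by apply/funext => w /=; rewrite TN /= natrK.
  - exists (~` B); split; first exact: measurableC.
      by rewrite /= -[LHS]/(mu _) muE setICl measure0 mul0e.
    move=> w /= nw Bw; apply: nw => _.
    move: Bw; rewrite /B /= TN lte_fin ltr_nat => tN.
    by rewrite -EFinB natrB// ltnW.
rewrite ge0_integral_natr_tail; last first.
  by move=> s; under eq_set do rewrite ltn_subRL addnC; exact: mN.
rewrite -(fineK PBfin) inver gt_eqF ?fine_gt0 ?PB0 -?ge0_fin_numE//.
(* Shifting the index by [t] lets both series start at 0, to be compared term by term: [s < N - t]
   means [s + t < N]. *)
rewrite -nneseriesZl// -[RHS]nneseries_addn; last first.
  by move=> s; rewrite mule_ge0// lee_fin invr_ge0 fine_ge0.
apply: eq_eseriesr => s _.
rewrite muE muleC -{1}(fineK PBfin) inver.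
rewrite gt_eqF ?fine_gt0 ?PB0 -?ge0_fin_numE//.
congr (_ * P _).
rewrite /B !tailE; apply/seteqP; split => w /=; rewrite ltn_subRL addnC.
  by case.
by move=> tsN; split => //; exact: leq_ltn_trans (leq_addr _ _) tsN.
Qed.
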